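(* Let $K$ be a number field, $c\in K$, $c\neq0$, and let $\mathcal{E}_2$ be the elliptic curve $y^2=x^3+c$, with $K_7=K(\mathcal{E}_2[7])$. For every $j\in\{1,\dots,6\}$, $$K_7=K\left(\sqrt[3]{\delta_jc},\zeta_3,\sqrt{(\delta_j+1)c}\right)=K\left(\sqrt[3]{\delta_jc},\zeta_7,\sqrt{(\delta_j+1)c}\right).$$
   Context: $K(\mathcal{E}[m])$ is the field generated over $K$ by the coordinates of the $m$-torsion points. Fix a primitive cube root of unity $\zeta_3$ and a primitive $7$th root of unity $\zeta_7$ in $\overline K$ (write $\zeta=\zeta_7$), and define $\delta_1=-\big((-132\zeta_3-120)\zeta^5+(-168\zeta_3-12)\zeta^4+(-24\zeta_3+60)\zeta^3+(-60\zeta_3-84)\zeta^2+(-192\zeta_3-96)\zeta-96\zeta_3+52\big)$; $\delta_2=-\big((-24\zeta_3-84)\zeta^5+(36\zeta_3-108)\zeta^4+(108\zeta_3-72)\zeta^3+(168\zeta_3+12)\zeta^2+(144\zeta_3+72)\zeta+72\zeta_3+64\big)$; $\delta_3=-\big((108\zeta_3+180)\zeta^5+(-60\zeta_3+24)\zeta^4+(132\zeta_3+120)\zeta^3+(-36\zeta_3+108)\zeta^2+(72\zeta_3+36)\zeta+36\zeta_3+172\big)$; $\delta_4=-\big((132\zeta_3+12)\zeta^5+(168\zeta_3+156)\zeta^4+(24\zeta_3+84)\zeta^3+(60\zeta_3-24)\zeta^2+(192\zeta_3+96)\zeta+96\zeta_3+148\big)$; $\delta_5=-\big((24\zeta_3-60)\zeta^5+(-36\zeta_3-144)\zeta^4+(-108\zeta_3-180)\zeta^3+(-168\zeta_3-156)\zeta^2+(-144\zeta_3-72)\zeta-72\zeta_3-8\big)$;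 $\delta_6=-\big((-108\zeta_3+72)\zeta^5+(60\zeta_3+84)\zeta^4+(-132\zeta_3-12)\zeta^3+(36\zeta_3+144)\zeta^2+(-72\zeta_3-36)\zeta-36\zeta_3+136\big)$. Cube and square roots denote fixed choices in $\overline K$; the point $(\sqrt[3]{\delta_jc},\sqrt{(\delta_j+1)c})$ is a point of exact order 7 on $\mathcal{E}_2$. *)

(* Defs.v *)
From HB Require Import structures.
From mathcomp Require Import all_boot all_order all_algebra all_field.
From mathcomp Require Import boolp classical_sets.

Set Implicit Arguments.
Unset Strict Implicit.
Unset Printing Implicit Defensive.

Import GRing.Theory.
Local Open Scope classical_set_scope.
Local Open Scope ring_scope.

Section Adjoin.
Variables (K L : fieldType) (iota : {rmorphism K -> L}).

Definition subfield_over (M : set L) : Prop :=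
  divring_closed (mem M) /\ range iota `<=` M.

Definition adjoin (S : set L) : set L := smallest subfield_over S.

End Adjoin.

(* The short Weierstrass curve y^2 = x^3 + a x + b over F, with its
   chord-and-tangent law.  The law is given on all pairs of coordinates, and is
   only meaningful on pairs of points satisfying on_curve: for those,
   x1 = x2 and y1 != - y2 force y1 = y2 != 0. *)
Section ShortWeierstrass.
Variables (F : fieldType) (a b : F).

Variant point : Type := Infinity | Affine of F & F.

Definition on_curve (P : point) : Prop :=
  if P is Affine x y then y ^+ 2 = x ^+ 3 + a * x + b else True.

Definition line_sum (l x1 y1 x2 : F) : point :=
  let x3 := l ^+ 2 - x1 - x2 in Affine x3 (l * (x1 - x3) - y1).

Definition add_point (P Q : point) : point :=
  match P, Q with
  | Infinity, _ => Q
  | _, Infinity => P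
  | Affine x1 y1, Affine x2 y2 =>
      if x1 != x2 then line_sum ((y2 - y1) / (x2 - x1)) x1 y1 x2
      else if y1 == - y2 then Infinity
      else line_sum ((3 * x1 ^+ 2 + a) / (2 * y1)) x1 y1 x2
  end.

Definition mul_point (m : nat) (P : point) : point :=
  iter m (add_point P) Infinity.

Definition torsion (m : nat) : set point :=
  [set P | on_curve P /\ mul_point m P = Infinity].

Definition torsion_coords (m : nat) : set F :=
  [set z | exists x y, torsion m (Affine x y) /\ (z = x \/ z = y)].

End ShortWeierstrass.

Definition torsion_field (K L : fieldType) (iota : {rmorphism K -> L})
    (a b : K) (m : nat) : set L :=
  adjoin iota (torsion_coords (iota a) (iota b) m).

(* delta z3 z j is the number delta_j attached to the roots of unity z3 (of
   order 3) and z (of order 7), for 1 <= j <= 6; its value 0 at any other j is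
   a dummy. *)
Definition delta (L : fieldType) (z3 z : L) (j : nat) : L :=
  match j with
  | 1 => - ((- 132 * z3 - 120) * z ^+ 5 + (- 168 * z3 - 12) * z ^+ 4
            + (- 24 * z3 + 60) * z ^+ 3 + (- 60 * z3 - 84) * z ^+ 2
            + (- 192 * z3 - 96) * z - 96 * z3 + 52)
  | 2 => - ((- 24 * z3 - 84) * z ^+ 5 + (36 * z3 - 108) * z ^+ 4
            + (108 * z3 - 72) * z ^+ 3 + (168 * z3 + 12) * z ^+ 2
            + (144 * z3 + 72) * z + 72 * z3 + 64)
  | 3 => - ((108 * z3 + 180) * z ^+ 5 + (- 60 * z3 + 24) * z ^+ 4
            + (132 * z3 + 120) * z ^+ 3 + (- 36 * z3 + 108) * z ^+ 2
            + (72 * z3 + 36) * z + 36 * z3 + 172)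
  | 4 => - ((132 * z3 + 12) * z ^+ 5 + (168 * z3 + 156) * z ^+ 4
            + (24 * z3 + 84) * z ^+ 3 + (60 * z3 - 24) * z ^+ 2
            + (192 * z3 + 96) * z + 96 * z3 + 148)
  | 5 => - ((24 * z3 - 60) * z ^+ 5 + (- 36 * z3 - 144) * z ^+ 4
            + (- 108 * z3 - 180) * z ^+ 3 + (- 168 * z3 - 156) * z ^+ 2
            + (- 144 * z3 - 72) * z - 72 * z3 - 8)
  | 6 => - ((- 108 * z3 + 72) * z ^+ 5 + (60 * z3 + 84) * z ^+ 4
            + (- 132 * z3 - 12) * z ^+ 3 + (36 * z3 + 144) * z ^+ 2
            + (- 72 * z3 - 36) * z - 36 * z3 + 136)
  | _ => 0
  end%R.

(* Main.v *)
Require Import Defs.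
From HB Require Import structures.
From mathcomp Require Import all_boot all_order all_algebra all_field.
From mathcomp Require Import boolp classical_sets ring.

Set Implicit Arguments.
Unset Strict Implicit.
Unset Printing Implicit Defensive.

Import GRing.Theory.
Local Open Scope classical_set_scope.
Local Open Scope ring_scope.

(** The curve has complex multiplication by the Eisenstein integers, where 7
    splits as [pi * pi'].  With [t := x ^ 3 / c], the 7-division polynomial is
    [(7 t ^ 2 - 4 t + 16) * psi6 t]: the roots of the first factor belong to the
    points killed by [pi] or [pi'], and those of [psi6] are the six [delta_j],
    which are conjugate over [Q(zeta3)].  A point [P] above a [delta_j] thus
    generates the 7-torsion as a module over the Eisenstein integers, so all
    torsion points are defined over the field generated by [P] and [zeta3].
    Concretely, multiplication by [sqrt(-3)] permutes the [delta_j] cyclically,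
    so they all lie in that field; [zeta7] is a [Q(zeta3)]-linear combination of
    values of a rational function at the [delta_j]; and the ratio of the
    coordinates of [pi P] to those of [P] is an explicit element of
    [Q(zeta3, zeta7)].  Conversely [zeta3 = (zeta3 x) / x] for torsion points
    [(x, y)] and [(zeta3 x, y)], and [zeta3] is affine in [delta_j] over
    [Q(zeta7)]. *)

(** * The chord-and-tangent law *)

Section GroupLaw.
Variables (F : fieldType) (a b : F).
Hypothesis two_neq0 : 2 != 0 :> F.
Hypothesis nonsingular : forall x : F,
  x ^+ 3 + a * x + b = 0 -> 3 * x ^+ 2 + a != 0.

Notation on_curve := (on_curve a b).
Notation "P +e Q" := (add_point a P Q) (at level 50, left associativity).

Definition opp_point (P : Defs.point F) : Defs.point F :=
  if P is Affine x y then Affine x (- y) else Infinity F.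

(* The line of slope [l] meets the curve in [(x1, y1)] and [(x2, y2)], with
   multiplicity: the second equation is the difference of the equations of the
   curve at the two points, divided by [x2 - x1], and
   says that the line is a tangent when [x1 = x2]. *)
Definition secant (l x1 y1 x2 y2 : F) : Prop :=
  y2 = y1 + l * (x2 - x1) /\
  2 * l * y1 + l ^+ 2 * (x2 - x1) = x2 ^+ 2 + x1 * x2 + x1 ^+ 2 + a.

Lemma add_pointP x1 y1 x2 y2 :
    on_curve (Affine x1 y1) -> on_curve (Affine x2 y2) ->
  [/\ x1 = x2, y1 = - y2 & Affine x1 y1 +e Affine x2 y2 = Infinity F] \/
  exists2 l, secant l x1 y1 x2 y2 &
    Affine x1 y1 +e Affine x2 y2 = line_sum l x1 y1 x2.
Proof.
move=> /= C1 C2; case: (eqVneq x1 x2) => [e|ne] /=.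
  case: (eqVneq y1 (- y2)) => [e'|ne']; first by left.
  right; exists ((3 * x1 ^+ 2 + a) / (2 * y1)) => //.
  move: C2 ne'; rewrite -{}e => {x2} C2 ne'.
  have e2 : y1 = y2.
    have /eqP : (y1 - y2) * (y1 + y2) = 0 by rewrite -subr_sqr C1 C2 subrr.
    by rewrite mulf_eq0 subr_eq0 addr_eq0 (negPf ne') orbF => /eqP.
  have y0 : y1 != 0.
    by apply: contraNneq ne' => y0; rewrite -e2 y0 oppr0.
  split; first by rewrite -e2 subrr mulr0 addr0.
  by rewrite subrr mulr0 addr0; field; apply/andP.
have d0 : x2 - x1 != 0 by rewrite subr_eq0 eq_sym.
right; exists ((y2 - y1) / (x2 - x1)) => //; split; first by field.
apply: (mulfI d0).
transitivity (y2 ^+ 2 - y1 ^+ 2); first by field.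
by rewrite C1 C2; ring.
Qed.

(** Unless the points are opposite, the [secant] equations determine the slope: by the first
    equation when [x1 != x2], otherwise by the second, where [y1 != 0]. *)
Lemma add_point_secant l x1 y1 x2 y2 :
    secant l x1 y1 x2 y2 -> ~ (x1 = x2 /\ y1 = - y2) ->
  Affine x1 y1 +e Affine x2 y2 = line_sum l x1 y1 x2.
Proof.
case=> e1 e2 nd /=; case: (eqVneq x1 x2) => [e|ne] /=; last first.
  congr line_sum; rewrite e1.
  have d0 : x2 - x1 != 0 by rewrite subr_eq0 eq_sym.
  by field.
case: (eqVneq y1 (- y2)) => [e'|ne']; first by case: nd.
have y12 : y2 = y1 by rewrite e1 e; ring.
have y0 : y1 != 0 by apply: contraNneq ne' => y0; rewrite y12 y0 oppr0.
congr line_sum; apply: (mulIf (mulf_neq0 two_neq0 y0)).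
rewrite divfK ?mulf_neq0 //.
by move: e2; rewrite -e subrr mulr0 addr0 => e2; ring: e2.
Qed.

Lemma on_curve_line_sum l x1 y1 x2 y2 :
    on_curve (Affine x1 y1) -> secant l x1 y1 x2 y2 ->
  on_curve (line_sum l x1 y1 x2).
Proof.
move=> /= C1 [_ e2].
have -> : b = y1 ^+ 2 - x1 ^+ 3 - a * x1 by rewrite C1; ring.
have -> : a = 2 * l * y1 + l ^+ 2 * (x2 - x1) - (x2 ^+ 2 + x1 * x2 + x1 ^+ 2).
  by rewrite e2; ring.
by ring.
Qed.

Lemma on_curve_add P Q : on_curve P -> on_curve Q -> on_curve (P +e Q).
Proof.
case: P Q => [|x1 y1] [|x2 y2] // C1 C2.
case: (add_pointP C1 C2) => [[_ _ ->] //|[l sl ->]].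
exact: on_curve_line_sum C1 sl.
Qed.

Lemma opp_add P Q : opp_point (P +e Q) = opp_point P +e opp_point Q.
Proof.
case: P Q => [|x1 y1] [|x2 y2] //=.
have opp_line l : opp_point (line_sum l x1 y1 x2) = line_sum (- l) x1 (- y1) x2.
  by rewrite /line_sum /=; congr Affine; ring.
case: (x1 != x2); first by rewrite opp_line -mulNr opprB opprK addrC.
rewrite (inj_eq oppr_inj); case: (y1 == - y2) => //.
by rewrite opp_line mulrN invrN mulrN.
Qed.

Lemma opp_pointK : involutive opp_point.
Proof. by case=> //= x y; rewrite opprK. Qed.

(** This cancellation stands in for associativity. The reflection in the [x]-axis of the line
    through [P] and [Q] passes through [-P] and [P + Q], and its third point is [-Q]. *)
Lemma addKp P Q : on_curve P -> on_curve Q -> opp_point P +e (P +e Q) = Q.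
Proof.
case: P Q => [|x1 y1] [|x2 y2] // C1 C2; first by rewrite /= eqxx /= eqxx.
case: (add_pointP C1 C2) => [[-> -> ->]|[l [e1 e2] ->]]; first by rewrite /= opprK.
rewrite /line_sum; set x3 := _ - x1 - x2; set y3 := _ - y1.
have sl : secant (- l) x1 (- y1) x3 y3.
  split; first by rewrite /y3; ring.
  have -> : a = 2 * l * y1 + l ^+ 2 * (x2 - x1) - (x2 ^+ 2 + x1 * x2 + x1 ^+ 2).
    by rewrite e2; ring.
  by rewrite /x3; ring.
rewrite /= -/(add_point a (Affine x1 (- y1)) (Affine x3 y3)).
rewrite (add_point_secant sl).
  by rewrite /line_sum /x3 e1; congr Affine; ring.
(* If [P + Q] were the opposite of [-P], the first secant equation would give [y1 = 0], and the
   second would make the curve singular at [P]. *)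
case=> ex /oppr_inj ey; case: sl; rewrite -{}ex -{}ey subrr !mulr0 !addr0 => ey.
have y0 : y1 = 0.
  apply/eqP; move/eqP: ey; rewrite -subr_eq0 opprK -mulr2n -mulr_natl.
  by rewrite mulf_eq0 (negPf two_neq0).
move=> e; have /eqP[] : 3 * x1 ^+ 2 + a != 0.
  by apply: nonsingular; rewrite -C1 y0 expr0n.
transitivity (x1 ^+ 2 + x1 * x1 + x1 ^+ 2 + a); first by ring.
by rewrite -e y0; ring.
Qed.

Lemma on_curve_mul n P : on_curve P -> on_curve (mul_point a n P).
Proof. by move=> CP; elim: n => //= n IHn; apply: on_curve_add. Qed.

Lemma mul_point_opp_shift m n P : on_curve P ->
  mul_point a m.+1 P = opp_point (mul_point a n P) <->
  mul_point a m P = opp_point (mul_point a n.+1 P).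
Proof.
move=> CP; have Cmul k := on_curve_mul k CP; split=> [e|e].
  rewrite -[LHS](addKp CP (Cmul m)).
  rewrite -[P +e _]/(mul_point a m.+1 P) e -opp_add.
  by rewrite -[P +e _]/(mul_point a n.+1 P).
rewrite [LHS]/= -/(mul_point a m P) e -[P in P +e _]opp_pointK -opp_add.
by rewrite -[mul_point a n.+1 P]/(P +e mul_point a n P) addKp.
Qed.

(** Three shifts balance the two sides, so that no multiple beyond [4 P] has to be computed. *)
Lemma mul7_point P : on_curve P ->
  mul_point a 7 P = Infinity F <-> mul_point a 4 P = opp_point (mul_point a 3 P).
Proof.
move=> CP; rewrite -[Infinity F]/(opp_point (mul_point a 0 P)).
by do 3!rewrite mul_point_opp_shift //.
Qed.

End GroupLaw.

(** * The 7-division polynomial of y^2 = x^3 + b *)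

(* [t ^ 6 + 564 t ^ 5 - 5808 t ^ 4 - 123136 t ^ 3 - 189696 t ^ 2 - 49152 t + 4096]:
   numerals denote unary numbers, hence the factorisations. *)
Definition psi6 (R : nzRingType) (t : R) : R :=
  t ^+ 6 + 564 * t ^+ 5 - 16 * 363 * t ^+ 4 - 64 * 1924 * t ^+ 3
    - 64 * 2964 * t ^+ 2 - 64 * 768 * t + 64 ^+ 2.

(* The 7-division polynomial of [y ^ 2 = x ^ 3 + b] at [x ^ 3 = t * b], up to a
   power of [b]. *)
Definition psi7 (R : nzRingType) (t : R) : R := (7 * t ^+ 2 - 4 * t + 16) * psi6 t.

Section SevenTorsion.
Variables (F : fieldType) (b : F).
Hypothesis two_neq0 : 2 != 0 :> F.
Hypothesis three_neq0 : 3 != 0 :> F.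
Hypothesis b_neq0 : b != 0.

Lemma j0_nonsingular (x : F) : x ^+ 3 + 0 * x + b = 0 -> 3 * x ^+ 2 + 0 != 0.
Proof.
move=> e; rewrite addr0 mulf_neq0 // expf_neq0 //.
by apply: contra_neq b_neq0 => x0; rewrite -e x0 expr0n /= mulr0 !add0r.
Qed.

(** The shape in which [psi7] arises as the numerator of [x (3 P) - x (4 P)]: the quartic comes from
    the slope of the line through [P] and [3 P], the cubic from [1 + 2 * x (3 P) / x P]. *)
Lemma psi7_sqr (t : F) :
  psi7 t = 16 * (t + 1) * (t ^+ 2 + 20 * t - 8) ^+ 2
             * (11 * t ^+ 3 - 120 * t ^+ 2 + 240 * t + 128)
           - (13 * t ^+ 4 + 52 * t ^+ 3 + 1536 * t ^+ 2 + 1024 * t + 256) ^+ 2.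
Proof. by rewrite /psi7 /psi6; ring. Qed.

Let smooth_neq0 m n : 2 ^+ m * 3 ^+ n != 0 :> F.
Proof. by rewrite mulf_neq0 ?expf_neq0. Qed.

(** The excluded values belong to points of order 3 ([t = 0], [t = -4]), 2 ([t = -1]) and 4 (the
    quadratic); the resultants of these factors with [psi7] have no prime divisors but 2 and 3. *)
Lemma psi7_root_generic (t : F) : psi7 t = 0 ->
  [/\ t != 0, t + 1 != 0, t + 4 != 0 & t ^+ 2 + 20 * t - 8 != 0].
Proof.
move=> root_t; split; apply/eqP => e.
- case/eqP: (smooth_neq0 16 0); move: root_t; rewrite /psi7 /psi6 e => <-; ring.
- have {}e : t = - 1 by rewrite -[RHS]add0r -e addrK.
  case/eqP: (smooth_neq0 0 12); move: root_t; rewrite psi7_sqr e => /eqP.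
  by rewrite -oppr_eq0 => /eqP <-; ring.
- have {}e : t = - 4 by rewrite -[RHS]add0r -e addrK.
  case/eqP: (smooth_neq0 16 8); move: root_t; rewrite psi7_sqr e => <-; ring.
have t2 : t ^+ 2 = 8 - 20 * t by rewrite -[RHS]add0r -e; ring.
(* The quartic of [psi7_sqr], reduced modulo [t ^ 2 + 20 * t - 8]; a Bezout relation then shows that
   [2 - 5 * t] has no common root with that quadratic. *)
have /eqP : (2 ^+ 5 * 3 ^+ 6 * (2 - 5 * t)) ^+ 2 = 0.
  rewrite -oppr0 -root_t psi7_sqr e.
  transitivity ((13 * t ^+ 4 + 52 * t ^+ 3 + 1536 * t ^+ 2 + 1024 * t + 256) ^+ 2);
    last by ring.
  by congr (_ ^+ 2); ring: t2.
rewrite expf_eq0 /= mulf_eq0 (negPf (smooth_neq0 5 6)) /= => /eqP e5.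
case/eqP: (smooth_neq0 2 0).
have -> : 2 ^+ 2 * 3 ^+ 0 = 25 * (t ^+ 2 + 20 * t - 8) + (2 - 5 * t) * (102 + 5 * t)
    :> F.
  by ring.
by rewrite e e5; ring.
Qed.

Section Point.
Variables x y t : F.
Hypothesis xt : x ^+ 3 = t * b.
Hypothesis yt : y ^+ 2 = (t + 1) * b.

Local Notation P := (Affine x y).

Let CP : on_curve 0 b P.
Proof. by rewrite /= yt xt; ring. Qed.

(** In units of [x] and [y], adding [P] involves only [t], because [y ^ 2 / x ^ 3 = (t + 1) / t]. *)
Lemma add_point_scale X Y : t != 0 -> X != 1 ->
  let m := (Y - 1) / (X - 1) in
  let X' := (t + 1) / t * m ^+ 2 - 1 - X in
  add_point 0 P (Affine (x * X) (y * Y)) =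
  Affine (x * X') (y * (m * (1 - X') - 1)).
Proof.
move=> t0 X1 m X'.
have x0 : x != 0.
  apply: contra_neq t0 => x0; apply: (mulIf b_neq0).
  by rewrite -xt x0 expr0n mul0r.
have X1' : X - 1 != 0 by rewrite subr_eq0.
have -> : add_point 0 P (Affine (x * X) (y * Y)) = line_sum (y / x * m) x y (x * X).
  rewrite /= -[X in X != _]mulr1 (inj_eq (mulfI x0)) eq_sym X1; congr line_sum.
  have -> : x * X - x = x * (X - 1) by ring.
  by rewrite /m; field; rewrite X1'.
have slope2 : (y / x * m) ^+ 2 = x * ((t + 1) / t * m ^+ 2).
  have -> : (y / x * m) ^+ 2 = y ^+ 2 * x / x ^+ 3 * m ^+ 2 by field.
  by rewrite yt xt; field; rewrite t0 b_neq0.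
rewrite /line_sum slope2; have -> : x * ((t + 1) / t * m ^+ 2) - x - x * X = x * X'.
  by rewrite /X'; ring.
by congr Affine; field.
Qed.

Lemma double_point : t + 1 != 0 ->
  add_point 0 P P = Affine (x * ((t - 8) / (4 * (t + 1))))
    (y * ((t ^+ 2 + 20 * t - 8) / (8 * (t + 1) ^+ 2))).
Proof.
move=> t1; have four0 : 4 != 0 :> F by rewrite (natrM _ 2 2) mulf_neq0.
have eight0 : 8 != 0 :> F by rewrite (natrM _ 2 4) mulf_neq0.
have y0 : y != 0.
  by have := mulf_neq0 t1 b_neq0; rewrite -yt expf_eq0.
have yN : (y == - y) = false.
  by rewrite -subr_eq0 opprK -mulr2n -mulr_natl mulf_eq0 (negPf two_neq0) (negPf y0).
have slope2 : ((3 * x ^+ 2 + 0) / (2 * y)) ^+ 2 = x * (9 * t / (4 * (t + 1))).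
  have -> : ((3 * x ^+ 2 + 0) / (2 * y)) ^+ 2 = 9 * x * x ^+ 3 / (4 * y ^+ 2).
    by field; rewrite y0 two_neq0 four0.
  by rewrite xt yt; field; rewrite t1 b_neq0 four0.
have x3 : x * (9 * t / (4 * (t + 1))) - x - x = x * ((t - 8) / (4 * (t + 1))).
  by field; rewrite t1 four0.
rewrite /= eqxx yN /line_sum slope2 x3; congr Affine.
apply: (mulfI y0).
transitivity (3 * x ^+ 3 / 2 * (1 - (t - 8) / (4 * (t + 1))) - y ^+ 2).
  by field; rewrite ?y0 ?t1 ?two_neq0 ?four0.
transitivity (y ^+ 2 * ((t ^+ 2 + 20 * t - 8) / (8 * (t + 1) ^+ 2)));
  last by field; rewrite t1 eight0.
by rewrite xt yt; field; rewrite t1 ?two_neq0 ?four0 ?eight0.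
Qed.

Lemma mul7_eq_infinity :
  mul_point 0 7 P = Infinity F <-> psi7 t = 0.
Proof.
rewrite (mul7_point two_neq0 j0_nonsingular CP).
have addPO : add_point 0 P (Infinity F) = P by [].
have four0 : 4 != 0 :> F by rewrite (natrM _ 2 2) mulf_neq0.
have eight0 : 8 != 0 :> F by rewrite (natrM _ 2 4) mulf_neq0.
have nine0 : 9 != 0 :> F by rewrite (natrM _ 3 3) mulf_neq0.
have [t1|t1] := eqVneq (t + 1) 0.
  split; last by case/psi7_root_generic=> _ /eqP[].
  have y0 : y = 0.
    have /eqP : y ^+ 2 = 0 by rewrite yt t1 mul0r.
    by rewrite expf_eq0 => /eqP.
  have dbl : add_point 0 P P = Infinity F by rewrite /= eqxx y0 oppr0 eqxx.
  by rewrite /mul_point !iterS addPO dbl addPO dbl.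
(* Here [2 P = - P], so [3 P] is infinity while [4 P = P] is not. *)
have opp2 : t * (t + 4) = 0 -> mul_point 0 4 P <> opp_point (mul_point 0 3 P).
  move=> tt; have dbl : add_point 0 P P = Affine x (- y).
    rewrite double_point //; case/eqP: tt; rewrite mulf_eq0 => /orP[/eqP t0|/eqP t4].
      have /eqP : x ^+ 3 = 0 by rewrite xt t0 mul0r.
      rewrite expf_eq0 /= => /eqP->; rewrite t0.
      by congr Affine; field.
    have -> : t = - 4 by rewrite -[RHS]add0r -t4 addrK.
    have n12 : 12 != 0 :> F by rewrite (natrM _ 3 4) mulf_neq0.
    have n72 : 72 != 0 :> F by rewrite (natrM _ 8 9) mulf_neq0.
    by congr Affine; field; rewrite ?oppr_eq0.
  rewrite /mul_point !iterS addPO dbl.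
  have -> : add_point 0 P (Affine x (- y)) = Infinity F by rewrite /= eqxx opprK eqxx.
  by [].
have [t0|t0] := eqVneq t 0.
  split=> [/opp2[]|/psi7_root_generic[/eqP[]] //]; by rewrite t0 mul0r.
have [t4|t4] := eqVneq (t + 4) 0.
  split=> [/opp2[]|/psi7_root_generic[_ _ /eqP[]] //]; by rewrite t4 mulr0.
have x0 : x != 0.
  apply: contra_neq t0 => x0; apply: (mulIf b_neq0).
  by rewrite -xt x0 expr0n mul0r.
set B := t ^+ 2 + 20 * t - 8.
pose X3 := (t ^+ 3 - 96 * t ^+ 2 + 48 * t + 64) / (9 * t * (t + 4) ^+ 2).
pose Y3 := (t ^+ 4 + 220 * t ^+ 3 - 1776 * t ^+ 2 - 320 * t - 512)
             / (27 * t * (t + 4) ^+ 3).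
have six0 : 6 != 0 :> F by rewrite (natrM _ 2 3) mulf_neq0.
have n27 : 27 != 0 :> F by rewrite (natrM _ 3 9) mulf_neq0.
have mul3 : mul_point 0 3 P = Affine (x * X3) (y * Y3).
  rewrite /mul_point !iterS addPO double_point // -/B.
  set X2 := _ / (4 * _); set Y2 := B / _.
  have X2E : X2 - 1 = - 3 * (t + 4) / (4 * (t + 1)).
    by rewrite /X2; field; rewrite t1 four0.
  have X21 : X2 != 1.
    by rewrite -subr_eq0 X2E !mulf_neq0 ?invr_eq0 ?oppr_eq0 ?mulf_neq0.
  have mE : (Y2 - 1) / (X2 - 1) = (7 * t ^+ 2 - 4 * t + 16) / (6 * (t + 1) * (t + 4)).
    rewrite X2E /Y2 /B; field.
    by rewrite ?oppr_eq0 ?t1 ?t4 ?two_neq0 ?three_neq0 ?four0 ?six0 ?eight0.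
  rewrite add_point_scale // mE.
  have -> : (t + 1) / t * ((7 * t ^+ 2 - 4 * t + 16) / (6 * (t + 1) * (t + 4))) ^+ 2
              - 1 - X2 = X3.
    by rewrite /X2 /X3; field; rewrite ?t0 ?t1 ?t4 ?four0 ?six0 ?nine0.
  congr Affine; congr (_ * _); rewrite /X3 /Y3; field.
  by rewrite ?t0 ?t1 ?t4 ?four0 ?six0 ?nine0 ?n27.
have mul4 : mul_point 0 4 P = add_point 0 P (Affine (x * X3) (y * Y3)).
  by rewrite -mul3.
have X3E : X3 - 1 = - 8 * (t + 1) * B / (9 * t * (t + 4) ^+ 2).
  by rewrite /X3 /B; field; rewrite ?t0 ?t4 ?nine0.
have Y3E : Y3 - 1 = - 2 * (13 * t ^+ 4 + 52 * t ^+ 3 + 1536 * t ^+ 2 + 1024 * t + 256)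
                      / (27 * t * (t + 4) ^+ 3).
  by rewrite /Y3; field; rewrite ?t0 ?t4 ?n27.
(* At a root of [B] one finds [3 P = - P], so [4 P] is infinity while [3 P] is not. *)
have [B0|B0] := eqVneq B 0.
  split=> [|/psi7_root_generic[_ _ _ /eqP[]] //].
  have X31 : X3 = 1 by apply/eqP; rewrite -subr_eq0 X3E B0 mulr0 mul0r.
  have Y31 : Y3 = - 1.
    apply/eqP; rewrite -subr_eq0 opprK.
    have -> : Y3 + 1 = 4 * B * (7 * t ^+ 2 - 4 * t + 16) / (27 * t * (t + 4) ^+ 3).
      by rewrite /Y3 /B; field; rewrite t0 t4 n27.
    by rewrite B0 mulr0 !mul0r.
  by rewrite mul4 mul3 X31 Y31 /= mulr1 mulrN1 eqxx opprK eqxx.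
have X31 : X3 != 1.
  by rewrite -subr_eq0 X3E !(mulf_neq0, invr_eq0, oppr_eq0, expf_neq0).
rewrite mul4 mul3 add_point_scale //=.
set m := _ / (X3 - 1); set X4 := _ - X3.
have mE : m = (13 * t ^+ 4 + 52 * t ^+ 3 + 1536 * t ^+ 2 + 1024 * t + 256)
                / (12 * (t + 4) * (t + 1) * B).
  have n8 : - 8 != 0 :> F by rewrite oppr_eq0.
  have n12 : 12 != 0 :> F by rewrite (natrM _ 3 4) mulf_neq0.
  by rewrite /m Y3E X3E; field; rewrite ?oppr_eq0 t0 t1 t4 B0 ?nine0 ?eight0 ?n27 ?n12.
have n144 : 144 != 0 :> F by rewrite (natrM _ 16 9) (natrM _ 4 4) !mulf_neq0.
have X4E : X4 - X3 = - psi7 t / (144 * t * (t + 4) ^+ 2 * (t + 1) * B ^+ 2).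
  rewrite /X4 mE /X3 psi7_sqr -/B.
  have n12 : 12 != 0 :> F by rewrite (natrM _ 3 4) mulf_neq0.
  by field; rewrite t0 t1 t4 B0 ?nine0 ?n12 ?n144.
split.
  case=> /(mulfI x0) /eqP; rewrite -subr_eq0 X4E => e _; apply/eqP; move: e.
  rewrite mulf_eq0 invr_eq0 oppr_eq0 orbC; case/orP=> //.
  by rewrite !(mulf_eq0, expf_eq0) (negPf t0) (negPf t1) (negPf t4) (negPf B0)
    (negPf n144).
(* Equal abscissas suffice: [- 4 P] lies on the line through [P] and [3 P], whose only point above
   [x (3 P)] is [3 P]. *)
move=> e; have e43 : X4 = X3.
  by apply/eqP; rewrite -subr_eq0 X4E e oppr0 mul0r.
rewrite e43; congr Affine; rewrite /m; field.
by rewrite subr_eq0.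
Qed.

End Point.
End SevenTorsion.

(** * The numbers delta_j *)

Lemma prim3_sqr (L : fieldType) (w : L) :
  3.-primitive_root w -> w ^+ 2 = - w - 1.
Proof.
move=> w_prim; have w1 : w - 1 != 0.
  by rewrite subr_eq0 -[w]expr1 -(prim_order_dvd w_prim).
apply: (mulfI w1); transitivity (1 - w ^+ 2); last by ring.
transitivity (w ^+ 3 - w ^+ 2); first by ring.
by rewrite (prim_expr_order w_prim).
Qed.

Lemma prim7_exp6 (L : fieldType) (z : L) : 7.-primitive_root z ->
  z ^+ 6 = - z ^+ 5 - z ^+ 4 - z ^+ 3 - z ^+ 2 - z - 1.
Proof.
move=> z_prim; have z1 : z - 1 != 0.
  by rewrite subr_eq0 -[z]expr1 -(prim_order_dvd z_prim).
apply: (mulfI z1); transitivity (1 - z ^+ 6); last by ring.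
transitivity (z ^+ 7 - z ^+ 6); first by ring.
by rewrite (prim_expr_order z_prim).
Qed.

Section Delta.
Variables (L : fieldType) (w z : L).
Hypothesis w_prim : 3.-primitive_root w.
Hypothesis z_prim : 7.-primitive_root z.

Let hw := prim3_sqr w_prim.
Let hz := prim7_exp6 z_prim.

(* The exponents realising the paper's numbering of the conjugates (index 0 is a
   dummy). *)
Definition delta_exp (j : nat) : nat := nth 1 [:: 1; 1; 5; 4; 6; 2; 3] j.

Lemma delta_conj j : (1 <= j <= 6)%N ->
  delta w z j = delta w (z ^+ delta_exp j) 1.
Proof.
case: j => [|[|[|[|[|[|[|j]]]]]]] //= _; rewrite /delta_exp /delta /=;
  by ring: hw hz.
Qed.

Lemma prod_delta (t : L) : \prod_(1 <= j < 7) (t - delta w z j) = psi6 t.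
Proof. by rewrite unlock /= /delta /psi6; ring: hw hz. Qed.

Lemma psi6_delta j : (1 <= j <= 6)%N -> psi6 (delta w z j) = 0.
Proof.
move=> j_range; apply/eqP; rewrite -prod_delta prodf_seq_eq0.
by apply/hasP; exists j; rewrite ?mem_index_iota //= subrr.
Qed.

(* The action of [sqrt(-3)] on [x ^ 3 / c]. *)
Lemma delta_sqrtN3 :
  27 * delta w (z ^+ 3) 1 * delta w z 1 ^+ 2 = - (delta w z 1 + 4) ^+ 3.
Proof. by rewrite -(@delta_conj 6) // /delta; ring: hw hz. Qed.

(* [x (2 P) / x P] at the points [P] with [x ^ 3 = delta_1 * c]. *)
Definition double_ratio (v : L) : L :=
  1 + (1 - w) * v ^+ 2 + (1 + 2 * w) * v ^+ 3 - (1 + 2 * w) * v ^+ 4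
    + (2 + w) * v ^+ 5.

Lemma double_ratioE :
  4 * double_ratio z * (delta w z 1 + 1) = delta w z 1 - 8.
Proof. by rewrite /delta /double_ratio; ring: hw hz. Qed.

(** The conjugates of [double_ratio] form a normal basis of [Q(zeta3, zeta7)] over [Q(zeta3)]; these
    are the coordinates of [27 * z] in it. *)
Lemma zeta7_double_ratio :
  27 * z = - (4 + 2 * w) * double_ratio z + (4 * w - 1) * double_ratio (z ^+ 2)
    + (1 - w) * double_ratio (z ^+ 3) + (2 + w) * double_ratio (z ^+ 4)
    - (5 + 4 * w) * double_ratio (z ^+ 5) + (2 * w - 2) * double_ratio (z ^+ 6).
Proof. by rewrite /double_ratio; ring: hw hz. Qed.

(* The ratios [x (pi P) / x P] and [y (pi P) / y P], multiplied by 7, for the two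
   primes [pi] above 7 of the ring of Eisenstein integers. *)
Lemma pi_torsion1 :
  (3 * w + 1 + (1 - 4 * w) * z + (w + 5) * (z ^+ 3 - z ^+ 4 + z ^+ 5)) ^+ 3
     * delta w z 1 = 49 * (- 12 * w - 4) /\
  (8 * w + 5 + (6 * w + 2) * (z + z ^+ 2 + z ^+ 3) + (4 * w + 6) * z ^+ 4
     + (12 * w + 4) * z ^+ 5) ^+ 2 * (delta w z 1 + 1) = 7 * (- 12 * w + 3).
Proof. by split; rewrite /delta; ring: hw hz. Qed.

Lemma pi_torsion2 :
  (- (7 * w + 7 + (4 * w + 5) * (z + z ^+ 5) + (5 * w + 1) * (z ^+ 2 + z ^+ 4)
     + (3 * w + 9) * z ^+ 3)) ^+ 3 * delta w z 1 = 49 * (12 * w + 8) /\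
  (1 - 2 * w + (6 * w + 4) * (z - z ^+ 2) + (2 * w + 6) * z ^+ 3) ^+ 2
     * (delta w z 1 + 1) = 7 * (12 * w + 15).
Proof. by split; rewrite /delta; ring: hw hz. Qed.

(* [delta w z 1] is affine in [w], with invertible linear coefficient. *)
Lemma zeta3_delta :
  84 * w =
    (37 * z ^+ 5 - 17 * z ^+ 4 + 41 * z ^+ 3 - 13 * z ^+ 2 + 24 * z + 12)
    * (delta w z 1 - 120 * z ^+ 5 - 12 * z ^+ 4 + 60 * z ^+ 3 - 84 * z ^+ 2
       - 96 * z + 52).
Proof. by rewrite /delta; ring: hw hz. Qed.

End Delta.

(** * Points over a subfield *)

Ltac mem_subfield :=
  repeat first [ assumption | apply: rpred_nat | apply: rpred1 | apply: rpredD
               | rewrite rpredN | apply: rpredM | apply: rpredX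
               | rewrite rpredV ].

Section Rationality.
Variables (L : fieldType) (M : divringClosed L) (b w : L).
Hypothesis pchar0 : has_pchar0 L.
Hypothesis w_prim : 3.-primitive_root w.
Hypothesis b_neq0 : b != 0.
Hypothesis Mb : b \in M.

Let nat_neq0 n : n.+1%:R != 0 :> L.
Proof. by rewrite (pcharf0P _).1. Qed.

Let hw := prim3_sqr w_prim.

(** One [M]-rational point above [t] is enough: once [w] lies in [M], all points above [t] are
    rational together. *)
Definition rational_at (t : L) : Prop :=
  exists x y, [/\ x \in M, y \in M, x ^+ 3 = t * b & y ^+ 2 = (t + 1) * b].

Lemma rational_at_mem t : rational_at t -> t \in M.
Proof.
case=> x [y [Mx _ xt _]].
by rewrite -(mulfK b_neq0 t) -xt rpred_div ?rpredX.
Qed.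

Hypothesis Mw : w \in M.

Lemma psi6_neq0 (t : L) : psi6 t = 0 -> t != 0 /\ t + 1 != 0.
Proof.
move=> e; have := @psi7_root_generic L (nat_neq0 1) (nat_neq0 2) t.
by rewrite /psi7 e mulr0 => /(_ erefl)[].
Qed.

Lemma rational_at_sqrtN3 t t' : t != 0 ->
  27 * t' * t ^+ 2 = - (t + 4) ^+ 3 -> rational_at t -> rational_at t'.
Proof.
move=> t0 tt [x [y [Mx My xt yt]]].
have Mt : t \in M by apply: rational_at_mem; exists x, y.
have t'E : t' = - (t + 4) ^+ 3 / (27 * t ^+ 2).
  have n27 := nat_neq0 26.
  by rewrite -tt; field; rewrite t0.
have u2 : (2 * w + 1) ^+ 2 = - 3 by ring: hw.
have u0 : 2 * w + 1 != 0.
  by have := nat_neq0 2; rewrite -oppr_eq0 -u2 expf_eq0.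
(* The image of [(x, y)] under multiplication by [sqrt(-3) = 2 * w + 1], up to sign; its abscissa is
   [- (x ^ 3 + 4 * b) / (3 * x ^ 2)]. *)
exists (- (x * (t + 4) / (3 * t))), (y * (t - 8) / (3 * (2 * w + 1) * t)).
split.
- by mem_subfield.
- by mem_subfield.
- transitivity (- (x ^+ 3 * (t + 4) ^+ 3 / (27 * t ^+ 3))).
    by field; rewrite t0 ?oppr_eq0 !nat_neq0.
  by rewrite xt t'E; field; rewrite t0 ?oppr_eq0 !nat_neq0.
transitivity (y ^+ 2 * (t - 8) ^+ 2 / (9 * (2 * w + 1) ^+ 2 * t ^+ 2)).
  by field; rewrite t0 u0 !nat_neq0.
rewrite u2 yt t'E; field.
by rewrite t0 ?oppr_eq0 !nat_neq0.
Qed.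

Lemma rational_at_delta_orbit z : 7.-primitive_root z ->
  rational_at (delta w z 1) -> rational_at (delta w (z ^+ 3) 1).
Proof.
move=> z_prim; apply: rational_at_sqrtN3 (delta_sqrtN3 w_prim z_prim).
by case: (psi6_neq0 (psi6_delta w_prim z_prim (isT : 1 <= 1 <= 6)%N)).
Qed.

(** Since 3 is a primitive root modulo 7, iterating [z -> z ^ 3] reaches every conjugate. *)
Lemma rational_at_delta_conj z k : 7.-primitive_root z -> (1 <= k <= 6)%N ->
  rational_at (delta w z 1) -> rational_at (delta w (z ^+ k) 1).
Proof.
move=> z_prim k_range rat_z.
have rat i : rational_at (delta w (z ^+ (3 ^ i)) 1).
  elim: i => // i IHi; rewrite expnS mulnC exprM.
  apply: rational_at_delta_orbit IHi.
  by rewrite prim_root_exp_coprime // coprimeXl.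
have {}rat i : rational_at (delta w (z ^+ (3 ^ i %% 7)) 1).
  by rewrite (prim_expr_mod z_prim).
case: k k_range => [|[|[|[|[|[|[|k]]]]]]] // _.
- exact: (rat 2%N). - exact: (rat 1%N).
- exact: (rat 4%N). - exact: (rat 5%N). - exact: (rat 3%N).
Qed.

Lemma zeta7_mem z : 7.-primitive_root z -> rational_at (delta w z 1) -> z \in M.
Proof.
move=> z_prim rat_z.
have Mp k : (1 <= k <= 6)%N -> double_ratio w (z ^+ k) \in M.
  move=> k_range.
  have zk_prim : 7.-primitive_root (z ^+ k).
    rewrite prim_root_exp_coprime //.
    by case: k k_range => [|[|[|[|[|[|[|k]]]]]]].
  have Md := rational_at_mem (rational_at_delta_conj z_prim k_range rat_z).
  have [_ d1] := psi6_neq0 (psi6_delta w_prim zk_prim (isT : 1 <= 1 <= 6)%N).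
  have d4 := mulf_neq0 (nat_neq0 3) d1.
  rewrite -(mulfK d4 (double_ratio w (z ^+ k))) mulrA (mulrC _ 4).
  rewrite double_ratioE //.
  by mem_subfield.
rewrite -(mulKf (nat_neq0 26) z) (zeta7_double_ratio w_prim z_prim).
have Mp1 : double_ratio w z \in M by rewrite -[z]expr1 Mp.
have [Mp2 Mp3] := (Mp 2 isT, Mp 3 isT).
have [[Mp4 Mp5] Mp6] := (Mp 4 isT, Mp 5 isT, Mp 6 isT).
by mem_subfield.
Qed.

Lemma rational_at_scale t t' g h : g \in M -> h \in M ->
  g ^+ 3 * t = t' -> h ^+ 2 * (t + 1) = t' + 1 ->
  rational_at t -> rational_at t'.
Proof.
move=> Mg Mh e3 e2 [x [y [Mx My xt yt]]].
exists (g * x), (h * y); split; rewrite ?rpredM //.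
  by rewrite exprMn xt mulrA e3.
by rewrite exprMn yt mulrA e2.
Qed.

Lemma rational_at_psi7_root z t : 7.-primitive_root z ->
  rational_at (delta w z 1) -> psi7 t = 0 -> rational_at t.
Proof.
move=> z_prim rat_z /eqP; have Mz := zeta7_mem z_prim rat_z.
have n7 := nat_neq0 6.
rewrite mulf_eq0 => /orP[|].
  rewrite -(inj_eq (mulfI n7)) mulr0.
  (* The quadratic factor splits over [Q(zeta3)], one root for each prime above 7. *)
  have -> : 7 * (7 * t ^+ 2 - 4 * t + 16) = (7 * t + 12 * w + 4) * (7 * t - 12 * w - 8).
    by ring: hw.
  rewrite mulf_eq0 => /orP[] /eqP e.
    have -> : t = (- 12 * w - 4) / 7.
      by apply: (mulfI n7); rewrite [RHS]mulrC divfK // -[RHS]add0r -e; ring.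
    have [e3 e2] := pi_torsion1 w_prim z_prim.
    apply: (@rational_at_scale (delta w z 1) _
      ((3 * w + 1 + (1 - 4 * w) * z + (w + 5) * (z ^+ 3 - z ^+ 4 + z ^+ 5)) / 7)
      ((8 * w + 5 + (6 * w + 2) * (z + z ^+ 2 + z ^+ 3) + (4 * w + 6) * z ^+ 4
         + (12 * w + 4) * z ^+ 5) / 7)) => //.
    - by mem_subfield.
    - by mem_subfield.
    - by rewrite expr_div_n mulrAC e3; field; rewrite ?nat_neq0.
    - by rewrite expr_div_n mulrAC e2; field; rewrite ?nat_neq0.
  have -> : t = (12 * w + 8) / 7.
    by apply: (mulfI n7); rewrite [RHS]mulrC divfK // -[RHS]add0r -e; ring.
  have [e3 e2] := pi_torsion2 w_prim z_prim.
  apply: (@rational_at_scale (delta w z 1) _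
    (- (7 * w + 7 + (4 * w + 5) * (z + z ^+ 5) + (5 * w + 1) * (z ^+ 2 + z ^+ 4)
       + (3 * w + 9) * z ^+ 3) / 7)
    ((1 - 2 * w + (6 * w + 4) * (z - z ^+ 2) + (2 * w + 6) * z ^+ 3) / 7)) => //.
  - by mem_subfield.
  - by mem_subfield.
  - by rewrite expr_div_n mulrAC e3; field; rewrite ?nat_neq0.
  - by rewrite expr_div_n mulrAC e2; field; rewrite ?nat_neq0.
rewrite -(prod_delta w_prim z_prim) prodf_seq_eq0 => /hasP[j].
rewrite mem_index_iota /= subr_eq0 => j_range /eqP->.
rewrite (delta_conj w_prim z_prim j_range); apply: rational_at_delta_conj => //.
by case: j j_range => [|[|[|[|[|[|[|j]]]]]]].
Qed.

(** The points above [t] differ by sixth roots of unity, which lie in [M]: cube roots of unity act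
    on [x], signs on [y]. *)
Lemma rational_at_points t x y : rational_at t ->
  x ^+ 3 = t * b -> y ^+ 2 = (t + 1) * b -> x \in M /\ y \in M.
Proof.
case=> x0 [y0 [Mx My <- <-]] ex ey; split.
  have /eqP : (x - x0) * (x - w * x0) * (x - w ^+ 2 * x0) = 0.
    transitivity (x ^+ 3 - x0 ^+ 3); last by rewrite ex subrr.
    by ring: hw.
  by rewrite !mulf_eq0 !subr_eq0 => /orP[/orP[]|] /eqP->; rewrite ?rpredM ?rpredX.
by move/eqP: ey; rewrite eqf_sqr => /orP[] /eqP->; rewrite ?rpredN.
Qed.

End Rationality.

Lemma zeta3_mem (L : fieldType) (M : divringClosed L) (w z : L) :
    has_pchar0 L -> 3.-primitive_root w -> 7.-primitive_root z ->
  z \in M -> delta w z 1 \in M -> w \in M.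
Proof.
move=> pchar0 w_prim z_prim Mz Md.
have n84 : 84 != 0 :> L by rewrite (pcharf0P _).1.
by rewrite -(mulKf n84 w) (zeta3_delta w_prim z_prim); mem_subfield.
Qed.

(** * Fields generated by a set *)

Section Adjunction.
Variables (K L : fieldType) (iota : {rmorphism K -> L}).
Implicit Types S : set L.

Lemma adjoin_gen S : S `<=` adjoin iota S.
Proof. exact: sub_gen_smallest. Qed.

Lemma adjoin_base S k : adjoin iota S (iota k).
Proof. by move=> M [[_ KM] _]; apply: KM; exists k. Qed.

Lemma adjoin_divring_closed S : divring_closed (mem (adjoin iota S)).
Proof.
split; first by rewrite inE => M [[[M1 _ _] _] _]; rewrite inE in M1.
  move=> x y; rewrite !inE => Sx Sy M MS; have [[[_ MB _] _] _] := MS.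
  have /MB := mem_set (Sx _ MS) => /(_ _ (mem_set (Sy _ MS))).
  by rewrite inE.
move=> x y; rewrite !inE => Sx Sy M MS; have [[[_ _ MV] _] _] := MS.
have /MV := mem_set (Sx _ MS) => /(_ _ (mem_set (Sy _ MS))).
by rewrite inE.
Qed.

Lemma adjoin_subfield S : subfield_over iota (adjoin iota S).
Proof.
split; first exact: adjoin_divring_closed.
by move=> _ [k _ <-]; apply: adjoin_base.
Qed.

Lemma adjoin_sub S S' : S `<=` adjoin iota S' -> adjoin iota S `<=` adjoin iota S'.
Proof. by apply: smallest_sub; apply: adjoin_subfield. Qed.

(** Carries the [divringClosed] structure that lets a generated field serve as the [M] of the
    rationality lemmas. *)
Definition adjoin_pred S : {pred L} := mem (adjoin iota S).

HB.instance Definition _ S :=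
  GRing.isDivringClosed.Build L (adjoin_pred S) (adjoin_divring_closed S).

Lemma adjoin_predE S x : x \in adjoin_pred S <-> adjoin iota S x.
Proof. by rewrite inE. Qed.

End Adjunction.

(** * Equality of the three fields *)

Theorem theorem4 (K : fieldExtType rat) (Kbar : closedFieldType)
    (iota : {rmorphism K -> Kbar})
    (Kbar_algebraic : forall u : Kbar, algebraicOver iota u)
    (c : K) (c_neq0 : c != 0)
    (zeta3 zeta7 : Kbar)
    (zeta3_prim : 3.-primitive_root zeta3)
    (zeta7_prim : 7.-primitive_root zeta7)
    (j : nat) (j_range : (1 <= j <= 6)%N)
    (r s : Kbar)
    (r_cbrt : r ^+ 3 = delta zeta3 zeta7 j * iota c)
    (s_sqrt : s ^+ 2 = (delta zeta3 zeta7 j + 1) * iota c) :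
  torsion_field iota 0 c 7 = adjoin iota [set r; zeta3; s] /\
  adjoin iota [set r; zeta3; s] = adjoin iota [set r; zeta7; s].
Proof.
have pchar0 : has_pchar0 Kbar.
  move=> p; rewrite (fmorph_pchar iota) pchar_lalg; exact: Num.Theory.pchar_num.
have two_neq0 : 2 != 0 :> Kbar by rewrite (pcharf0P _).1.
have three_neq0 : 3 != 0 :> Kbar by rewrite (pcharf0P _).1.
have b_neq0 : iota c != 0 by rewrite fmorph_eq0.
have root_delta := psi6_delta zeta3_prim zeta7_prim j_range.
have [d0 _] := psi6_neq0 pchar0 root_delta.
have r_neq0 : r != 0.
  by have := mulf_neq0 d0 b_neq0; rewrite -r_cbrt expf_eq0.
(* With [z] as the chosen seventh root of unity, [delta_j] becomes [delta_1]. *)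
pose z := zeta7 ^+ delta_exp j.
have z_prim : 7.-primitive_root z.
  rewrite prim_root_exp_coprime //.
  by case: j {r_cbrt s_sqrt root_delta d0 z} j_range => [|[|[|[|[|[|[|j]]]]]]].
(* By Fermat, the fifth power of an exponent prime to 7 is its inverse modulo 7. *)
have zeta7E : zeta7 = z ^+ (delta_exp j ^ 5).
  rewrite /z -exprM -expnS -(prim_expr_mod zeta7_prim).
  by case: j {r_cbrt s_sqrt root_delta d0 z z_prim} j_range => [|[|[|[|[|[|[|j]]]]]]].
have dz := delta_conj zeta3_prim zeta7_prim j_range; rewrite -/z in dz.
have zeta7_gen S : adjoin iota S r -> adjoin iota S s -> adjoin iota S zeta3 ->
    adjoin iota S zeta7 /\ torsion_coords (iota 0) (iota c) 7 `<=` adjoin iota S.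
  rewrite -!adjoin_predE => Sr Ss S3.
  have Sb : iota c \in adjoin_pred iota S by apply/adjoin_predE; apply: adjoin_base.
  have ratz : rational_at (adjoin_pred iota S) (iota c) (delta zeta3 z 1).
    by exists r, s; rewrite -dz.
  split.
    rewrite zeta7E; apply/rpredX.
    exact: (zeta7_mem pchar0 zeta3_prim b_neq0 Sb S3 z_prim ratz).
  move=> v [x [y [[]]]]; rewrite /= rmorph0 mul0r addr0 => Cxy mul7 vxy.
  pose t := x ^+ 3 / iota c.
  have xt : x ^+ 3 = t * iota c by rewrite divfK.
  have yt : y ^+ 2 = (t + 1) * iota c by rewrite mulrDl -xt mul1r.
  have root_t := (mul7_eq_infinity two_neq0 three_neq0 b_neq0 xt yt).1 mul7.
  have ratt := rational_at_psi7_root pchar0 zeta3_prim b_neq0 Sb S3 z_prim ratz root_t.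
  have [Sx Sy] := rational_at_points zeta3_prim S3 ratt xt yt.
  by case: vxy => ->; apply/adjoin_predE.
have zeta3_gen S : adjoin iota S r -> adjoin iota S zeta7 -> adjoin iota S zeta3.
  rewrite -!adjoin_predE => Sr S7; apply: (zeta3_mem pchar0 zeta3_prim z_prim).
    by rewrite rpredX.
  rewrite -dz -(mulfK b_neq0 (delta _ _ _)) -r_cbrt rpred_div ?rpredX //.
  by apply/adjoin_predE; apply: adjoin_base.
(* Any cube root of [r ^ 3] is allowed so that [(zeta3 * r, s)] is covered along with [(r, s)]; the
   quotient of their abscissas is [zeta3]. *)
have torsion_point x : x ^+ 3 = r ^+ 3 ->
    torsion (iota 0) (iota c) 7 (Affine x s).
  rewrite r_cbrt => xt; split.
    by rewrite /= rmorph0 mul0r addr0 xt s_sqrt mulrDl mul1r.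
  rewrite rmorph0; apply/(mul7_eq_infinity two_neq0 three_neq0 b_neq0 xt s_sqrt).
  by rewrite /psi7 root_delta mulr0.
split; apply/seteqP; split; apply: adjoin_sub.
- by have [|||//] := @zeta7_gen [set r; zeta3; s]; apply: adjoin_gen => /=; tauto.
- have gen x : x ^+ 3 = r ^+ 3 -> adjoin iota (torsion_coords (iota 0) (iota c) 7) x.
    by move=> xr; apply: adjoin_gen; exists x, s; split; [apply: torsion_point|left].
  have Kr := gen r erefl.
  move=> v [[->//|->]|->]; last first.
    by apply: adjoin_gen; exists r, s; split; [apply: torsion_point|right].
  have /gen : (zeta3 * r) ^+ 3 = r ^+ 3.
    by rewrite exprMn (prim_expr_order zeta3_prim) mul1r.
  rewrite -!adjoin_predE in Kr * => K3r.
  by rewrite -(mulfK r_neq0 zeta3) rpred_div.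
- have z3 : adjoin iota [set r; zeta7; s] zeta3.
    by apply: zeta3_gen; apply: adjoin_gen => /=; tauto.
  by move=> v [[->|->]|->] //; apply: adjoin_gen => /=; tauto.
- have [||| z7 _] := @zeta7_gen [set r; zeta3; s];
    try by apply: adjoin_gen => /=; tauto.
  by move=> v [[->|->]|->] //; apply: adjoin_gen => /=; tauto.
Qed.
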